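(* Let $G$ be a finite nilpotent group of odd order and let $K$ be a DDP group of even order. Then the direct product $G \times K$ is a DDP group.
   Context: A finite group $G$ of order $n$ is a DDP group if there is a permutation $g_0,\ldots,g_{n-1}$ of the elements of $G$ (each element listed exactly once) such that $g_0=1_G$ and $g_i^{-1}g_{i+1}\neq g_j^{-1}g_{j+1}$ for all $0\le i<j<n-1$. *)

(* Defs.v *)
From mathcomp Require Import all_boot all_fingroup all_solvable.

Set Implicit Arguments.
Unset Strict Implicit.
Unset Printing Implicit Defensive.

Local Open Scope group_scope.

(* The listing g_0, ..., g_(n-1) of G, with n = #|G|, is a duplicate-free
   sequence s with the same elements as G (so size s = #|G|), and
   g_i = nth 1 s i.  Since j < n - 1, the default value of nth is never read
   in the last condition. *)
Definition DDP_group (gT : finGroupType) (G : {group gT}) : Prop :=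
  exists s : seq gT,
    [/\ uniq s,
        s =i G,
        nth 1 s 0 = 1 &
        forall i j : nat, (i < j)%N -> (j < #|G| - 1)%N ->
          (nth 1 s i)^-1 * nth 1 s i.+1 <> (nth 1 s j)^-1 * nth 1 s j.+1].

(* Main.v *)
Require Import Defs.
From mathcomp Require Import all_boot all_fingroup all_solvable.
From mathcomp Require Import zify.

(** Let [Q] be a DDP group of even order [m] and [H ->> Q] a surjection whose
    kernel [<[z]>] is central of odd order [k].  Sweep the listing of [Q]
    [k] times, alternately forwards and backwards: a coset [d] of the kernel is
    then used by [(k+1)/2] forward and [(k-1)/2] backward sweeps, i.e. [k] times.
    Lift the quotients of [Q] by a section [e] with [e d^-1 = (e d)^-1] and
    multiply the [i]-th entry of sweep [t] by [z ^ ((-1)^i (2t+1))].  Inside a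
    sweep the lifted quotients get multiplied by [z ^ (2 (-1)^(i+1) (2t+1))], and,
    [m] being even, the step from sweep [t] to the next one is [z ^ (4 (t+1))].
    All these are distinct because [2t+1 = - (2t'+1)] modulo [k] forces
    [t + t' = k - 1], so that [t] and [t'] have the same parity.
    The theorem follows by induction on [#|G|], killing a central element. *)

Set Implicit Arguments.
Unset Strict Implicit.
Unset Printing Implicit Defensive.

Local Open Scope group_scope.

(** * Listings as functions of an index *)

Definition sequencing (gT : finGroupType) (A : {set gT}) n (f : nat -> gT) :=
  [/\ forall i, (i < n)%N -> f i \in A,
      forall i j, (i < n)%N -> (j < n)%N -> f i = f j -> i = j &
      forall i j, (i.+1 < n)%N -> (j.+1 < n)%N ->
        (f i)^-1 * f i.+1 = (f j)^-1 * f j.+1 -> i = j].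

Lemma DDP_group_sequencing (gT : finGroupType) (G : {group gT}) :
  DDP_group G -> exists f, sequencing G #|G| f.
Proof.
move=> [s [s_uniq sG _ s_quo]]; exists (nth 1 s).
have sz : size s = #|G| by rewrite -(card_uniqP s_uniq); apply: eq_card.
split=> [i ltiG | i j | i j ltiG ltjG quo].
- by rewrite -sG mem_nth ?sz.
- by rewrite -sz => lti ltj /eqP; rewrite nth_uniq // => /eqP.
case: (ltngtP i j) => // lt_ij.
- by case: (s_quo i j); rewrite // ltn_subRL add1n.
- by case: (s_quo j i); rewrite // ltn_subRL add1n.
Qed.

(** Left translation by [(f 0)^-1] preserves all consecutive quotients and moves the first entry to
    1; [#|G|] distinct elements of [G] exhaust it. *)
Lemma sequencing_DDP_group (gT : finGroupType) (G : {group gT}) f :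
  sequencing G #|G| f -> DDP_group G.
Proof.
move=> [fG f_inj f_quo].
have G_gt0 := cardG_gt0 G.
pose s := mkseq (fun i => (f 0)^-1 * f i) #|G|.
have s_uniq : uniq s.
  by apply/mkseq_uniqP => i j; rewrite !inE => ltiG ltjG /mulgI; apply: f_inj.
have sG : {subset s <= enum G}.
  move=> x /mapP[i]; rewrite mem_iota add0n => /andP[_ ltiG] ->.
  by rewrite mem_enum groupM ?groupV ?fG.
exists s; split=> //.
- move=> x; rewrite -[RHS]mem_enum.
  have s_size : (size (enum G) <= size s)%N by rewrite size_mkseq -cardE.
  by have [_ ->] := uniq_min_size s_uniq sG s_size.
- by rewrite nth_mkseq ?mulVg.
move=> i j lt_ij; rewrite ltn_subRL add1n => ltjG.
have ltiG : (i.+1 < #|G|)%N by apply: leq_ltn_trans ltjG; apply: ltnW.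
rewrite !nth_mkseq /=; try by [exact: ltnW | exact: ltiG | exact: ltjG].
rewrite !invMg !invgK -!mulgA !mulKVg.
by move/(f_quo _ _ ltiG ltjG) => eq_ij; rewrite eq_ij ltnn in lt_ij.
Qed.

(** * Powers of an element of odd order *)

(** For odd [n], the power [(n.+1)./2] undoes squaring on elements killed by [n]. *)
Lemma odd_sqrg_inj (gT : finGroupType) (u v : gT) n :
  odd n -> u ^+ n = 1 -> v ^+ n = 1 -> u ^+ 2 = v ^+ 2 -> u = v.
Proof.
move=> n_odd un vn uv.
have root (x : gT) : x ^+ n = 1 -> x = (x ^+ 2) ^+ (n.+1)./2.
  by move=> xn; rewrite -expgM (_ : (2 * _)%N = n.+1) ?expgS ?xn ?mulg1 //; lia.
by rewrite (root u) // (root v) // uv.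
Qed.

(** The kernel factor put on entry [i] of sweep [t]. *)
Definition twist (gT : finGroupType) (z : gT) t i :=
  if odd i then z ^- (2 * t).+1 else z ^+ (2 * t).+1.

Lemma twist_cycle (gT : finGroupType) (z : gT) t i : twist z t i \in <[z]>.
Proof. by rewrite /twist; case: ifP; rewrite ?groupV mem_cycle. Qed.

Lemma twistS (gT : finGroupType) (z : gT) t i :
  twist z t i.+1 = (twist z t i)^-1.
Proof. by rewrite /twist /=; case: (odd i); rewrite ?invgK. Qed.

Lemma twist_eq (gT : finGroupType) (z : gT) t t' i i' :
  odd #[z] -> (t < #[z])%N -> (t' < #[z])%N -> twist z t i = twist z t' i' ->
  odd t = odd t' /\ (odd i = odd i' -> t = t').
Proof.
move=> z_odd ltt ltt'.
have zX n : (z ^+ n) ^+ #[z] = 1 by rewrite -expgM mulnC expgM expg_order expg1n.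
have same : z ^+ (2 * t).+1 = z ^+ (2 * t').+1 -> t = t'.
  rewrite !expgS => /mulgI; rewrite ![(2 * _)%N]mulnC !expgM.
  move/(odd_sqrg_inj z_odd (zX _) (zX _)) => /eqP.
  by rewrite eq_expg_mod_order !modn_small // => /eqP.
have opposite : z ^+ (2 * t).+1 * z ^+ (2 * t').+1 = 1 -> odd t = odd t'.
  rewrite -expgD (_ : (_ + _)%N = ((t + t').+1 * 2)%N); last by lia.
  rewrite expgM -(expg1n gT 2) => /(odd_sqrg_inj z_odd (zX _) (expg1n _ _)) /eqP.
  (* Since [0 < t + t' + 1 < 2 * #[z]], the only possible multiple is [#[z]] itself, which is
     odd. *)
  by rewrite -order_dvdn => /dvdnP[[|[|q]]] ?; nia.
rewrite /twist; case: (odd i) (odd i') => [] [] eq_tw.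
- by have -> := same (invg_inj eq_tw).
- by split=> //; apply: opposite; rewrite -eq_tw mulgV.
- by split=> //; apply: opposite; rewrite eq_tw mulVg.
- by have -> := same eq_tw.
Qed.

(** * Lifting a listing through a central cyclic kernel of odd order *)

Section CentralCyclicExtension.

Variables (hT qT : finGroupType) (H : {group hT}) (Q : {group qT}).
Variables (pi : {morphism H >-> qT}) (z : hT).
Hypothesis piH : pi @* H = Q.
Hypothesis kerz : 'ker pi = <[z]>.
Hypothesis zC : z \in 'C(H).
Hypothesis z_odd : odd #[z].

Let zker : z \in 'ker pi. Proof. by rewrite kerz cycle_id. Qed.

Let zH : z \in H. Proof. exact: (subsetP (subsetIl _ _) _ zker). Qed.

Let kerC x y : x \in <[z]> -> y \in H -> commute x y.
Proof.
move=> xz yH; apply: (centP _ _ yH).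
by apply: (subsetP _ _ xz); rewrite cycle_subG.
Qed.

(** Compatibility with inversion ensures that a quotient [d] has the same lift [e d] whether a
    forward or a backward sweep produces it. *)
Lemma symmetric_section :
  exists e : qT -> hT,
    {in Q, forall d, [/\ e d \in H, pi (e d) = d & e d^-1 = (e d)^-1]}.
Proof.
have lift d : d \in Q -> exists x, (x \in H) && (pi x == d).
  by rewrite -piH => /morphimP[x xH _ ->]; exists x; rewrite xH eqxx.
pose s d := odflt 1 [pick x in H | pi x == d].
have sP d : d \in Q -> s d \in H /\ pi (s d) = d.
  move=> /lift[x /andP[xH xd]]; rewrite /s.
  case: pickP => [y /andP[yH /eqP] //|/(_ x)].
  by rewrite xH xd.
(* [s d * s d^-1] is central; dividing [s d] by its square root makes the
   section compatible with inversion. *)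
pose n d := s d * s d^-1.
have nP d : d \in Q -> n d \in <[z]>.
  move=> dQ; have dVQ : d^-1 \in Q by rewrite groupV.
  have [sH sd] := sP d dQ; have [sVH sdV] := sP _ dVQ.
  rewrite -kerz; apply/kerP; first by rewrite groupM.
  by rewrite morphM //= sd sdV mulgV.
have nV d : d \in Q -> n d^-1 = n d.
  move=> dQ; have [sH _] := sP d dQ.
  by apply: (mulgI (s d)); rewrite -(kerC (nP d dQ) sH) /n invgK mulgA.
pose r d := n d ^- (#[z].+1)./2.
have rP d : d \in Q -> r d \in <[z]> by move=> dQ; rewrite groupV groupX ?nP.
have zsubH : <[z]> \subset H by rewrite cycle_subG.
exists (fun d => s d * r d) => d dQ.
have dVQ : d^-1 \in Q by rewrite groupV.
have [sH sd] := sP d dQ; have [sVH sdV] := sP _ dVQ.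
have rH : r d \in H by apply: (subsetP zsubH); apply: rP.
have rker : pi (r d) = 1 by apply: mker; rewrite kerz rP.
split; first by rewrite groupM.
  by rewrite morphM // sd rker mulg1.
have rV : r d^-1 = r d by rewrite /r nV.
apply: (mulgI (s d * r d)); rewrite mulgV rV.
rewrite -mulgA (mulgA (r d)) (kerC (rP d dQ) sVH) -!mulgA (mulgA (s d)) -/(n d).
have /eqP nz : n d ^+ #[z] == 1 by rewrite -order_dvdn order_dvdG ?nP.
by rewrite /r -invMg -expgD addnn even_halfK ?expgS ?nz ?mulg1 ?mulgV //= z_odd.
Qed.

Lemma DDP_group_central_cyclic_extension :
  DDP_group Q -> ~~ odd #|Q| -> DDP_group H.
Proof.
move=> /DDP_group_sequencing[q]; have := cardG_gt0 Q.
have : #|H| = (#|Q| * #[z])%N.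
  have kerH : 'ker pi \subset H by apply: subsetIl.
  by rewrite -(Lagrange kerH) -piH card_morphim setIid mulnC /= kerz.
move: #|Q| => m cardH m_gt0 [qQ q_inj q_quo] m_even.
have [e eP] := symmetric_section.
have zsubH : <[z]> \subset H by rewrite cycle_subG.
have twH t i : twist z t i \in H by rewrite (subsetP zsubH) ?twist_cycle.
have pi_tw t i : pi (twist z t i) = 1 by rewrite mker ?kerz ?twist_cycle.
pose D p := (q p)^-1 * q p.+1.
have DQ p : (p.+1 < m)%N -> D p \in Q.
  by move=> ltp; rewrite groupM ?groupV ?qQ // ltnW.
pose L := fix L p := if p is p'.+1 then L p' * e (D p') else e (q 0).
have LP p : (p < m)%N -> L p \in H /\ pi (L p) = q p.
  elim: p => [|p IHp] ltp; first by have [] := eP _ (qQ 0 ltp).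
  have [LH piL] := IHp (ltnW ltp); have [eH pie _] := eP _ (DQ p ltp).
  by rewrite /= groupM // morphM // piL pie mulKVg.
pose pos t i := if odd t then m - i.+1 else i.
have pos_lt t i : (i < m)%N -> (pos t i < m)%N.
  by rewrite /pos; case: (odd t); lia.
pose Dt t i := if odd t then (D (m - i.+2))^-1 else D i.
have DtQ t i : (i.+1 < m)%N -> Dt t i \in Q.
  by move=> lti; rewrite /Dt; case: (odd t); rewrite ?groupV DQ //; lia.
have L_step t i : (i.+1 < m)%N -> (L (pos t i))^-1 * L (pos t i.+1) = e (Dt t i).
  move=> lti; rewrite /pos /Dt; case: (odd t); last by rewrite /= mulKg.
  have ltD : ((m - i.+2).+1 < m)%N by lia.
  have [_ _ ->] := eP _ (DQ _ ltD).
  by rewrite (_ : m - i.+1 = (m - i.+2).+1)%N /= ?invMg ?mulgKV //; lia.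
pose h t i := L (pos t i) * twist z t i.
have hH t i : (i < m)%N -> h t i \in H.
  by move=> lti; rewrite groupM //; have [] := LP _ (pos_lt t i lti).
have pi_h t i : (i < m)%N -> pi (h t i) = q (pos t i).
  move=> lti; have [LH piL] := LP _ (pos_lt t i lti).
  by rewrite morphM // piL pi_tw mulg1.
have h_step t i : (i.+1 < m)%N ->
    (h t i)^-1 * h t i.+1 = e (Dt t i) * twist z t i.+1 ^+ 2.
  move=> lti; have [eH _ _] := eP _ (DtQ t i lti).
  rewrite /h invMg -mulgA (mulgA (L _)^-1) L_step // -twistS.
  by rewrite mulgA (kerC (twist_cycle _ _ _) eH) mulgA.
have h_turn t : (h t m.-1)^-1 * h t.+1 0 = z ^+ (2 * t.+1 * 2).
  have posE : pos t.+1 0 = pos t m.-1.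
    by rewrite /pos /=; case: (odd t) => /=; lia.
  have tw : (twist z t m.-1)^-1 = z ^+ (2 * t).+1.
    by rewrite /twist (_ : odd m.-1) ?invgK //; lia.
  rewrite /h posE invMg -mulgA mulKg tw /twist /= -expgD.
  by congr (_ ^+ _); lia.
pose f r := h (r %/ m) (r %% m).
have fE t i : (i < m)%N -> f (t * m + i)%N = h t i.
  by move=> lti; rewrite /f divnMDl // divn_small // addn0 modnMDl modn_small.
have repr r : (r < m * #[z])%N ->
    exists t i, [/\ r = (t * m + i)%N, (i < m)%N & (t < #[z])%N].
  move=> ltr; exists (r %/ m), (r %% m).
  by rewrite -divn_eq ltn_mod m_gt0 ltn_divLR // mulnC.
have D_neq1 p : (p.+1 < m)%N -> D p != 1.
  move=> ltp; apply/eqP => /(canRL (mulKVg _)); rewrite mulg1.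
  by move/(q_inj _ _ ltp (ltnW ltp)); lia.
have Dt_neq1 t i : (i.+1 < m)%N -> Dt t i != 1.
  move=> lti; rewrite /Dt; case: (odd t); last exact: D_neq1.
  by rewrite invg_eq1 D_neq1; lia.
have Dt_inj t t' i i' : odd t = odd t' -> (i.+1 < m)%N -> (i'.+1 < m)%N ->
    Dt t i = Dt t' i' -> i = i'.
  move=> tt' lti lti'; rewrite /Dt tt'; case: (odd t'); last exact: q_quo.
  by move/invg_inj/q_quo; lia.
have pi_step t i : (i.+1 < m)%N -> pi (e (Dt t i) * twist z t i.+1 ^+ 2) = Dt t i.
  move=> lti; have [eH pie _] := eP _ (DtQ t i lti).
  by rewrite morphM ?groupX // pie morphX // pi_tw expg1n mulg1.
have pi_z n : pi (z ^+ n) = 1 by rewrite mker ?groupX.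
have zX n : (z ^+ n) ^+ #[z] = 1 by rewrite -expgM mulnC expgM expg_order expg1n.
have twX t i : twist z t i ^+ #[z] = 1.
  by have /cycleP[n ->] := twist_cycle z t i.
apply: (@sequencing_DDP_group _ _ f); rewrite cardH; split.
- move=> r ltr; have [t [i [-> lti _]]] := repr r ltr.
  by rewrite fE ?hH.
- move=> r r' ltr ltr'.
  have [t [i [-> lti ltt]]] := repr r ltr.
  have [t' [i' [-> lti' ltt']]] := repr r' ltr'.
  rewrite !fE // => eq_h.
  have eq_pos : pos t i = pos t' i'.
    by apply: q_inj; rewrite ?pos_lt // -!pi_h // eq_h.
  move: eq_h; rewrite /h eq_pos => /mulgI/(twist_eq z_odd ltt ltt')[odd_tt' eq_t].
  have eq_i : i = i' by move: eq_pos; rewrite /pos odd_tt'; case: (odd t'); lia.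
  by rewrite eq_i eq_t // eq_i.
have steps r : (r.+1 < m * #[z])%N -> exists t i,
    [/\ r = (t * m + i)%N, (t < #[z])%N & ((i.+1 < m)%N /\
      (f r)^-1 * f r.+1 = e (Dt t i) * twist z t i.+1 ^+ 2) \/
      [/\ i = m.-1, (t.+1 < #[z])%N & (f r)^-1 * f r.+1 = z ^+ (2 * t.+1 * 2)]].
  move=> ltr; have [t [i [r_eq lti ltt]]] := repr r (ltnW ltr).
  exists t, i; split=> //; case: (ltnP i.+1 m) => [ltiS|geiS]; [left|right].
    by split=> //; rewrite r_eq -addnS !fE // h_step.
  have i_eq : i = m.-1 by lia.
  have rS_eq : r.+1 = (t.+1 * m + 0)%N by rewrite r_eq i_eq mulSn; lia.
  split=> //; last by rewrite rS_eq r_eq !fE // i_eq h_turn.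
  by rewrite -(ltn_pmul2l m_gt0) mulnC -[(_ * m)%N]addn0 -rS_eq.
move=> r r' ltr ltr'.
have [t [i [r_eq ltt step]]] := steps r ltr.
have [t' [i' [r_eq' ltt' step']]] := steps r' ltr'.
case: step step' => [[lti ->]|[eq_i lttS ->]] [[lti' ->]|[eq_i' lttS' ->]] eq_f.
- have eq_Dt : Dt t i = Dt t' i' by rewrite -(pi_step t i lti) eq_f pi_step.
  move: eq_f; rewrite eq_Dt => /mulgI/(odd_sqrg_inj z_odd (twX _ _) (twX _ _)).
  case/(twist_eq z_odd ltt ltt') => odd_tt' eq_t.
  have eq_i : i = i' by apply: Dt_inj eq_Dt.
  by rewrite r_eq r_eq' eq_i eq_t // eq_i.
- by have := Dt_neq1 t i lti; rewrite -(pi_step t i lti) eq_f pi_z eqxx.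
- by have := Dt_neq1 t' i' lti'; rewrite -(pi_step t' i' lti') -eq_f pi_z eqxx.
move: eq_f; rewrite expgM [RHS]expgM => /(odd_sqrg_inj z_odd (zX _) (zX _)).
rewrite mulnC [in RHS]mulnC expgM [RHS]expgM.
move/(odd_sqrg_inj z_odd (zX _) (zX _))/eqP.
rewrite eq_expg_mod_order !modn_small // => /eqP[eq_t].
by rewrite r_eq r_eq' eq_i eq_i' eq_t.
Qed.

End CentralCyclicExtension.

Theorem theorem9 (gT kT : finGroupType) (G : {group gT}) (K : {group kT}) :
  nilpotent G -> odd #|G| ->
  DDP_group K -> ~~ odd #|K| ->
  DDP_group (setX_group G K).
Proof.
have [n] := ubnP #|G|; elim: n => // n IHn in gT G * => ltGn nilG oddG ddpK evK.
have [G1 | ntG] := eqVneq (G : {set gT}) 1.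
  have sndM : {in setX_group G K &, {morph snd : x y / x * y}} by [].
  apply: (@DDP_group_central_cyclic_extension _ _ _ K (Morphism sndM) 1) => //.
  - apply/setP => k; apply/morphimP/idP => [[[a b] _ /setXP[_ bK] ->] // | kK].
    by exists (1, k); rewrite // in_setX group1.
  - apply/setP => -[a b]; rewrite cycle1 !inE /= G1 inE [RHS]xpair_eqE.
    by case: (b =P 1) => [->|]; rewrite ?group1 ?andbF ?andbT.
  - by rewrite order1.
have [z zZ ntz] : exists2 z, z \in 'Z(G) & z != 1.
  by apply/trivgPn; rewrite (center_nil_eq1 nilG).
have [zG zC] : z \in G /\ z \in 'C(G) by move: zZ; rewrite inE => /andP.
have sub_zG : <[z]> \subset G by rewrite cycle_subG.
have nzG : G \subset 'N(<[z]>) by rewrite cents_norm // centsC cycle_subG.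
pose proj (x : gT * kT) := (coset <[z]> x.1, x.2).
have projM : {in setX_group G K &, {morph proj : x y / x * y}}.
  move=> [a b] [a' b'] /setXP[aG _] /setXP[a'G _]; rewrite /proj /=.
  by rewrite morphM // (subsetP nzG).
have cycX i : ((z, 1) : gT * kT) ^+ i = (z ^+ i, 1).
  by elim: i => // i IHi; rewrite !expgS IHi /= -[1 in RHS](mulg1 (1 : kT)).
apply: (@DDP_group_central_cyclic_extension _ _ _
  (setX_group (G / <[z]>) K) (Morphism projM) (z, 1)).
- apply/setP => -[a k].
  apply/morphimP/setXP => [[[g b] _ /setXP[gG bK] [-> ->]] | [aG kK]].
    by rewrite mem_quotient.
  have /morphimP[g _ gG a_eq] := aG.
  by exists (g, k); rewrite ?in_setX ?gG // a_eq.
- apply/setP => -[g k]; apply/idP/cycleP => [|[i ->]].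
    rewrite !inE /= => /andP[/andP[gG kK]]; rewrite /proj xpair_eqE /=.
    case/andP => /eqP g1 /eqP ->.
    have /cycleP[i ->] : g \in <[z]>.
      by apply: coset_idr; rewrite ?(subsetP nzG).
    by exists i; rewrite cycX.
  rewrite cycX !inE /= groupX // group1 /proj xpair_eqE /= eqxx andbT.
  by rewrite coset_id ?mem_cycle.
- apply/centP => -[g k] /setXP[gG _]; congr (_, _).
    exact: (centP zC).
  by rewrite /= mul1g mulg1.
- apply: dvdn_odd oddG; apply: dvdn_trans (order_dvdG zG).
  by rewrite order_dvdn cycX expg_order.
- apply: IHn => //.
  + by apply: leq_trans (ltn_quotient _ sub_zG) _; rewrite ?cycle_eq1 // -ltnS.
  + exact: quotient_nil.
  + exact: dvdn_odd (dvdn_quotient _ _) oddG.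
by rewrite cardsX oddM negb_and evK orbT.
Qed.
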